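(* Let $\mathcal{A}$ be an abelian category and let $\mathcal{X}$ be a precovering self-orthogonal subcategory of $\mathcal{A}$ which is closed under extensions and direct summands. Assume that $\mathcal{X}$ is $\mathrm{Hom}$-faithful. Then, for an object $M$ of $\mathcal{A}$ and an integer $n\geq 0$, the following are equivalent. 1. $\mathrm{l}_{\mathcal{X}}\text{-}\dim(M)\leq n$. 2. $\mathrm{Ext}^{n+1}_{\mathcal{X}}(M,N)=0$ for every object $N\in\mathcal{A}$. 3. $\mathrm{Ext}^{i}_{\mathcal{X}}(M,N)=0$ for every $i\geq n+1$ and every object $N\in\mathcal{A}$.
   Context: ''Subcategory'' means full subcategory closed under isomorphisms and containing the zero object. $\mathcal{X}$ is precovering if every object $M$ of $\mathcal{A}$ admits an $\mathcal{X}$-precover, i.e. a morphism $\varphi:X\to M$ with $X\in\mathcal{X}$ such that $\mathrm{Hom}(X',\varphi)$ is surjective for every $X'\in\mathcal{X}$. $\mathcal{X}$ is self-orthogonal if $\mathrm{Ext}^i(X,X')=0$ for all $i\geq 1$ and all $X,X'\in\mathcal{X}$ (Yoneda Ext in $\mathcal{A}$). $\mathcal{X}$ is $\mathrm{Hom}$-faithful if, for every object $N$ of $\mathcal{A}$, $\mathrm{Hom}(X,N)=0$ for all $X\in\mathcal{X}$ implies $N=0$. A proper left $\mathcal{X}$-resolution of $M$ is a complex (not necessarily exact) $\cdots\to X_1\to X_0\to M\to 0$ with all $X_i\in\mathcal{X}$ which becomes exact after applying $\mathrm{Hom}(X,-)$ for every $X\in\mathcal{X}$. We write $\mathrm{l}_{\mathcal{X}}\text{-}\dim(M)\leq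 n$ if $M$ has a proper left $\mathcal{X}$-resolution of the form $0\to A_n\to\cdots\to A_0\to M\to 0$. The relative Ext groups are $\mathrm{Ext}^i_{\mathcal{X}}(M,N)=H^i(\mathrm{Hom}(X_\bullet,N))$ for $i\geq 0$, where $X_\bullet=(\cdots\to X_1\to X_0\to 0)$ is the deleted complex of a proper left $\mathcal{X}$-resolution of $M$ (this is independent of the choice of resolution up to isomorphism). *)

(* Defs.v *)
From HB Require Import structures.
From mathcomp Require Import all_boot all_algebra.
From mathcomp Require Import boolp.
From Stdlib Require Import Relation_Operators.

Set Implicit Arguments.
Unset Strict Implicit.
Unset Printing Implicit Defensive.

Import GRing.Theory.
Local Open Scope ring_scope.

Record preadditive := Preadditive {
  obj :> Type;
  hom : obj -> obj -> zmodType;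
  idm : forall A, hom A A;
  comp : forall A B D, hom B D -> hom A B -> hom A D;
  comp_idl : forall A B (f : hom A B), comp (idm B) f = f;
  comp_idr : forall A B (f : hom A B), comp f (idm A) = f;
  comp_assoc : forall A B D E (h : hom D E) (g : hom B D) (f : hom A B),
    comp h (comp g f) = comp (comp h g) f;
  comp_addl : forall A B D (g g' : hom B D) (f : hom A B),
    comp (g + g') f = comp g f + comp g' f;
  comp_addr : forall A B D (g : hom B D) (f f' : hom A B),
    comp g (f + f') = comp g f + comp g f'
}.
Arguments idm {p} A.

Notation "g \oc f" := (comp g f) (at level 40, left associativity).

Section Category.
Variable C : preadditive.
Implicit Types A B D : C.

Definition is_zero Z :=
  (forall A (f : hom A Z), f = 0) /\ (forall A (f : hom Z A), f = 0).

Definition isomorphic A B :=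
  exists (f : hom A B) (g : hom B A), g \oc f = idm A /\ f \oc g = idm B.

Definition is_mono A B (f : hom A B) :=
  forall D (g h : hom D A), f \oc g = f \oc h -> g = h.

Definition is_epi A B (f : hom A B) :=
  forall D (g h : hom B D), g \oc f = h \oc f -> g = h.

Definition is_kernel A B (f : hom A B) K (k : hom K A) :=
  f \oc k = 0 /\
  forall D (g : hom D A), f \oc g = 0 -> exists! h : hom D K, k \oc h = g.

Definition is_cokernel A B (f : hom A B) Q (q : hom B Q) :=
  q \oc f = 0 /\
  forall D (g : hom B D), g \oc f = 0 -> exists! h : hom Q D, h \oc q = g.

Definition is_biproduct A B S (i : hom A S) (j : hom B S)
    (p : hom S A) (q : hom S B) :=
  [/\ p \oc i = idm A, q \oc j = idm B, q \oc i = 0, p \oc j = 0 &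
      i \oc p + j \oc q = idm S].

Record abelian : Prop := Abelian {
  has_zero : exists Z, is_zero Z;
  has_biproducts : forall A B, exists S i j p q, @is_biproduct A B S i j p q;
  has_kernels : forall A B (f : hom A B), exists K k, @is_kernel A B f K k;
  has_cokernels : forall A B (f : hom A B), exists Q q, @is_cokernel A B f Q q;
  mono_normal : forall A B (f : hom A B), is_mono f ->
    exists D (g : hom B D), is_kernel g f;
  epi_conormal : forall A B (f : hom A B), is_epi f ->
    exists D (g : hom D A), is_cokernel g f
}.

Definition is_image A B (f : hom A B) I (m : hom I B) :=
  exists Q (q : hom B Q), is_cokernel f q /\ is_kernel q m.

Definition exact A B D (f : hom A B) (g : hom B D) :=
  exists I (m : hom I B), is_image f m /\ is_kernel g m.

Definition short_exact A B D (f : hom A B) (g : hom B D) :=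
  [/\ is_mono f, exact f g & is_epi g].

(* The sequence A, E_0, E_1, ...; a map [hom (aug A E k.+1) (aug A E k)] is
   E_0 -> A for k = 0 and E_k -> E_(k-1) for k > 0, definitionally. *)
Definition aug A (E : nat -> C) (k : nat) : C :=
  if k is k'.+1 then E k' else A.

(* An (m+1)-fold extension 0 -> B -> E_m -> ... -> E_0 -> A -> 0. The objects
   E_k and the maps with source E_k for k > m carry no condition. *)
Record extension (m : nat) A B := Extension {
  ext_obj : nat -> C;
  ext_map : forall k, hom (aug A ext_obj k.+1) (aug A ext_obj k);
  ext_incl : hom B (ext_obj m);
  ext_epi : is_epi (ext_map 0);
  ext_exact : forall k, (k < m)%N -> exact (ext_map k.+1) (ext_map k);
  ext_exact_last : exact (ext_incl : hom B (aug A ext_obj m.+1)) (ext_map m);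
  ext_mono : is_mono ext_incl
}.

Definition ext_morphism m A B (E F : extension m A B) :=
  exists phi : forall k, hom (ext_obj E k) (ext_obj F k),
  [/\ (ext_map F 0 : hom (ext_obj F 0) A) \oc phi 0%N = ext_map E 0,
      forall k, (k < m)%N ->
        (ext_map F k.+1 : hom (ext_obj F k.+1) (ext_obj F k)) \oc phi k.+1 =
        phi k \oc (ext_map E k.+1 : hom (ext_obj E k.+1) (ext_obj E k)) &
      phi m \oc ext_incl E = ext_incl F].

Definition yoneda_equiv m A B : extension m A B -> extension m A B -> Prop :=
  clos_refl_sym_trans _ (@ext_morphism m A B).

(* Ext^(m+1)(A, B) is the collection of Yoneda equivalence classes of
   (m+1)-fold extensions; as a group it is 0 iff it has only one class. *)
Definition Ext_vanishes m A B :=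
  forall E F : extension m A B, yoneda_equiv E F.

Variable X : C -> Prop.

Definition subcategory :=
  (forall A B, isomorphic A B -> X A -> X B) /\ (forall Z, is_zero Z -> X Z).

Definition is_precover A M (phi : hom A M) :=
  X A /\ forall A', X A' -> forall f : hom A' M,
    exists g : hom A' A, phi \oc g = f.

Definition precovering := forall M, exists A (phi : hom A M), is_precover phi.

(* Index [m] stands for the degree m + 1, so all degrees >= 1 are covered. *)
Definition self_orthogonal :=
  forall m A B, X A -> X B -> Ext_vanishes m A B.

Definition Hom_faithful :=
  forall N, (forall A, X A -> forall f : hom A N, f = 0) -> is_zero N.

Definition extension_closed :=
  forall A B D (f : hom A B) (g : hom B D),
    short_exact f g -> X A -> X D -> X B.

Definition summand_closed :=
  forall A B S (i : hom A S) (j : hom B S) (p : hom S A) (q : hom S B),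
    is_biproduct i j p q -> X S -> X A.

(* The complex ... -> P_1 -> P_0 -> M -> 0 itself need not be exact; it is so
   after applying Hom(A, -) for A in X: [res_proper0] is exactness at
   Hom(A, M), and [res_proper] exactness at Hom(A, P_k). *)
Record proper_resolution M := ProperResolution {
  res_obj : nat -> C;
  res_map : forall k, hom (aug M res_obj k.+1) (aug M res_obj k);
  res_in : forall k, X (res_obj k);
  res_complex : forall k, res_map k \oc res_map k.+1 = 0;
  res_proper0 : forall A, X A -> forall f : hom A M,
    exists g : hom A (res_obj 0), (res_map 0 : hom (res_obj 0) M) \oc g = f;
  res_proper : forall k A, X A -> forall f : hom A (res_obj k),
    res_map k \oc (f : hom A (aug M res_obj k.+1)) = 0 ->
    exists g : hom A (res_obj k.+1),
      (res_map k.+1 : hom (res_obj k.+1) (res_obj k)) \oc g = f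
}.

Definition dim_le M n :=
  exists P : proper_resolution M, forall k, (n < k)%N -> is_zero (res_obj P k).

End Category.

(* Concentrated in degrees >= 0, so the coboundaries in degree 0 are zero. *)
Record cochain := Cochain {
  coch :> nat -> zmodType;
  delta : forall k, {additive coch k -> coch k.+1};
  delta_delta : forall k (x : coch k), delta k.+1 (delta k x) = 0
}.

Section Cohomology.
Variables (K : cochain) (i : nat).

Definition is_cocycle : {pred K i} := fun x => delta K i x == 0.

Fact is_cocycle_zmod_closed : zmod_closed is_cocycle.
Proof.
split=> [|x y]; first by rewrite unfold_in raddf0.
by rewrite !unfold_in raddfB => /eqP-> /eqP->; rewrite subr0.
Qed.
HB.instance Definition _ :=
  GRing.isZmodClosed.Build _ is_cocycle is_cocycle_zmod_closed.

Record cocycle := Cocycle { coval :> K i; _ : coval \in is_cocycle }.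
HB.instance Definition _ := [isSub for coval].
HB.instance Definition _ := [Choice of cocycle by <:].
HB.instance Definition _ := [SubChoice_isSubZmodule of cocycle by <:].

Definition boundary : K i -> Prop :=
  match i return K i -> Prop with
  | 0 => fun x => x = 0
  | j.+1 => fun x => exists y, delta K j y = x
  end.

Definition is_coboundary : {pred cocycle} := fun x => `[< boundary (coval x) >].

Fact is_coboundary_zmod_closed : zmod_closed is_coboundary.
Proof.
rewrite /is_coboundary /boundary; split=> [|x y]; rewrite !unfold_in.
  apply/asboolP; have -> : coval (0 : cocycle) = 0 by exact: (raddf0 val).
  by case: i => [//|j]; exists 0; rewrite raddf0.
move=> /asboolP bx /asboolP by_; apply/asboolP.
have -> : coval (x - y) = coval x - coval y by exact: (raddfB val).
move: (coval x) (coval y) bx by_.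
case: i => [a b -> ->|j a b [a' <-] [b' <-]]; first by rewrite subr0.
by exists (a' - b'); rewrite raddfB.
Qed.
HB.instance Definition _ :=
  GRing.isZmodClosed.Build _ is_coboundary is_coboundary_zmod_closed.

Definition cohomology : zmodType := Quotient.quot is_coboundary.

Lemma cohomology0P :
  (forall h : cohomology, h = 0) <->
  (forall x : K i, delta K i x = 0 -> boundary x).
Proof.
have eq0 (x : cocycle) :
    (\pi_(Quotient.quot is_coboundary) x == 0 :> cohomology)%qT =
    (x \in is_coboundary).
  have -> : 0 = (\pi_(Quotient.quot is_coboundary) 0)%qT :> cohomology.
    by rewrite raddf0.
  by rewrite -Quotient.idealrBE subr0.
split=> [h0 x dx0 | bnd h].
  have zx : x \in is_cocycle by rewrite unfold_in dx0.
  have : Cocycle zx \in is_coboundary by rewrite -eq0; apply/eqP/h0.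
  by rewrite unfold_in => /asboolP.
elim/quotW: (h : Quotient.quot is_coboundary) => x.
apply/eqP; rewrite eq0 unfold_in; apply/asboolP/bnd.
exact/eqP/(valP x).
Qed.

End Cohomology.

Section RelativeExt.
Variables (C : preadditive) (X : C -> Prop).

Definition precomp (A B N : C) (u : hom A B) (f : hom B N) : hom A N := f \oc u.

Fact precomp_is_zmod_morphism (A B N : C) (u : hom A B) :
  zmod_morphism (@precomp A B N u).
Proof.
move=> f g; apply: (addIr (precomp u g)).
by rewrite /precomp -comp_addl !subrK.
Qed.
HB.instance Definition _ (A B N : C) (u : hom A B) :=
  GRing.isZmodMorphism.Build _ _ (@precomp A B N u)
    (@precomp_is_zmod_morphism A B N u).

Section HomComplex.
Variables (M : C) (P : proper_resolution X M) (N : C).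

Let Hom_coch k : zmodType := hom (res_obj P k) N.

Let Hom_delta k : {additive Hom_coch k -> Hom_coch k.+1} :=
  @precomp (res_obj P k.+1) (res_obj P k) N (res_map P k.+1).

Fact Hom_delta_delta k (x : Hom_coch k) : Hom_delta k.+1 (Hom_delta k x) = 0.
Proof.
rewrite /= /precomp -comp_assoc.
have -> : (res_map P k.+1 : hom (res_obj P k.+1) (res_obj P k))
    \oc (res_map P k.+2 : hom (res_obj P k.+2) (res_obj P k.+1)) = 0.
  exact: (res_complex P k.+1).
by apply: (addIr (x \oc 0)); rewrite -comp_addr !add0r.
Qed.

(* The augmentation [res_map P 0] is left out: P is the deleted complex here. *)
Definition Hom_complex : cochain := Cochain Hom_delta_delta.

Definition rel_Ext i : zmodType := cohomology Hom_complex i.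

End HomComplex.

Section Existence.
Hypotheses (abC : abelian C) (preX : precovering X) (M : C).

Record stage := Stage { src : C; tgt : C; arr : hom src tgt }.

Let covers B D (f : hom B D) T (g : hom T B) :=
  [/\ X T, f \oc g = 0 & forall A, X A -> forall u : hom A B,
     f \oc u = 0 -> exists v : hom A T, g \oc v = u].

Let exists_cover (s : stage) :
  exists t : {T : C & hom T (src s)}, covers (arr s) (projT2 t).
Proof.
have [K [k [fk0 kU]]] := has_kernels abC (arr s).
have [T [phi [XT phiP]]] := preX K.
exists (existT _ T (k \oc phi)); split=> //=.
  rewrite comp_assoc fk0; apply: (addIr (0 \oc phi)).
  by rewrite -comp_addl !add0r.
move=> A XA u fu0; have [w [kw _]] := kU _ _ fu0.
have [v phiv] := phiP _ XA w; exists v.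
by rewrite -comp_assoc phiv.
Qed.

Lemma proper_resolution_exists : inhabited (proper_resolution X M).
Proof.
pose next s := projT1 (cid (exists_cover s)).
have nextP s : covers (arr s) (projT2 (next s)) := projT2 (cid (exists_cover s)).
have [P0 [phi0 [XP0 phi0P]]] := preX M.
pose st := fix st k := if k is k'.+1
  then Stage (projT2 (next (st k'))) else Stage phi0.
pose P k := src (st k).
pose d k : hom (aug M P k.+1) (aug M P k) :=
  match k return hom (aug M P k.+1) (aug M P k) with
  | 0 => phi0
  | k'.+1 => projT2 (next (st k'))
  end.
have dE k : covers (d k) (d k.+1).
  by case: k => [|k]; [exact: (nextP (st 0%N)) | exact: (nextP (st k.+1))].
split; exists P d => //.
- by case=> [//|k]; case: (nextP (st k)).
- by move=> k; case: (dE k).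
- by move=> k A XA f; case: (dE k) => _ _; apply.
Qed.

End Existence.

End RelativeExt.

(* Main.v *)
From mathcomp Require Import all_boot all_algebra.
From mathcomp Require Import boolp.
Require Import Defs.

(** Comparing [P] with a proper resolution of length [n] through a homotopy
    equivalence gives, above degree [n], a partial contraction of [P], hence the
    vanishing of the relative Ext groups there.

    Conversely, let [q : P_(n+1) -> N] be the cokernel of [P_(n+2) -> P_(n+1)].
    The map [q] is a cocycle, so if Ext^(n+1)(M, N) = 0 it factors as
    [q = h \oc d_(n+1)]; writing [d_(n+1) = e \oc q], this gives
    [h \oc e = idm N]. So [e] embeds [N] as a direct summand of [P_n], and
    replacing [P_n] by the complementary summand ker h and all higher terms by 0
    yields a proper resolution of length [n]. *)

Set Implicit Arguments.
Unset Strict Implicit.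
Unset Printing Implicit Defensive.

Import GRing.Theory.
Local Open Scope ring_scope.

Lemma comp0l (C : preadditive) (A B D : C) (f : hom A B) :
  (0 : hom B D) \oc f = 0.
Proof. by apply: (addIr (0 \oc f)); rewrite -comp_addl !add0r. Qed.

Lemma comp0r (C : preadditive) (A B D : C) (f : hom B D) :
  f \oc (0 : hom A B) = 0.
Proof. by apply: (addIr (f \oc 0)); rewrite -comp_addr !add0r. Qed.

Lemma comp_subl (C : preadditive) (A B D : C) (f g : hom B D) (h : hom A B) :
  (f - g) \oc h = f \oc h - g \oc h.
Proof. by apply: (addIr (g \oc h)); rewrite -comp_addl !subrK. Qed.

Lemma comp_subr (C : preadditive) (A B D : C) (h : hom B D) (f g : hom A B) :
  h \oc (f - g) = h \oc f - h \oc g.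
Proof. by apply: (addIr (h \oc g)); rewrite -comp_addr !subrK. Qed.

Lemma kernel_mono (C : preadditive) (A B : C) (f : hom A B) K (k : hom K A) :
  is_kernel f k -> is_mono k.
Proof.
move=> [fk0 kU] D g h kgh.
have [|u [_ uU]] := kU _ (k \oc g); first by rewrite comp_assoc fk0 comp0l.
by rewrite -(uU g) // -(uU h).
Qed.

Lemma cokernel_epi (C : preadditive) (A B : C) (f : hom A B) Q (q : hom B Q) :
  is_cokernel f q -> is_epi q.
Proof.
move=> [qf0 qU] D g h gqh.
have [|u [_ uU]] := qU _ (g \oc q); first by rewrite -comp_assoc qf0 comp0r.
by rewrite -(uU g) // -(uU h).
Qed.

(** The idempotent [idm S - e \oc h] is killed by [h], so it factors through the kernel [i]; the
    factor is the projection [p]. *)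
Lemma split_complement (C : preadditive) (A S Q : C) (e : hom A S) (h : hom S A)
    (i : hom Q S) :
  h \oc e = idm A -> is_kernel h i ->
  exists p : hom S Q, is_biproduct i e p h.
Proof.
move=> he ker_i; have i_mono := kernel_mono ker_i.
have [hi0 iU] := ker_i.
have [|p [ip _]] := iU _ (idm S - e \oc h).
  by rewrite comp_subr comp_idr comp_assoc he comp_idl subrr.
exists p; split=> //.
- apply: i_mono.
  by rewrite comp_assoc ip comp_subl comp_idl -comp_assoc hi0 comp0r subr0
             comp_idr.
- apply: i_mono.
  by rewrite comp_assoc ip comp_subl comp_idl -comp_assoc he comp_idr subrr
             comp0r.
- by rewrite ip subrK.
Qed.

Section Resolutions.
Variables (C : preadditive) (X : C -> Prop) (M : C).

Lemma rel_Ext0P (P : proper_resolution X M) N k :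
  (forall h : rel_Ext P N k.+1, h = 0) <->
  (forall x : hom (aug M (res_obj P) k.+2) N, x \oc res_map P k.+2 = 0 ->
     exists y : hom (aug M (res_obj P) k.+1) N, y \oc res_map P k.+1 = x).
Proof. exact: cohomology0P. Qed.

(** The induction needs to remember one degree only: the first two equations let [a] and [b] lift to
    the next degree, and the third yields the next homotopy, with [s] taking the place of [t]. *)
Lemma comparison_homotopy (P R : proper_resolution X M) k :
  exists (a : hom (aug M (res_obj P) k.+1) (aug M (res_obj R) k.+1))
         (b : hom (aug M (res_obj R) k.+1) (aug M (res_obj P) k.+1))
         (s : hom (aug M (res_obj P) k.+1) (aug M (res_obj P) k.+2))
         (t : hom (aug M (res_obj P) k) (aug M (res_obj P) k.+1)),
  [/\ res_map R k \oc (a \oc res_map P k.+1) = 0,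
      res_map P k \oc (b \oc res_map R k.+1) = 0 &
      idm _ - b \oc a = res_map P k.+1 \oc s + t \oc res_map P k].
Proof.
elim: k => [|k [a [b [s [t [ra db hst]]]]]].
  have [a ra] := res_proper0 R (res_in P 0) (res_map P 0).
  have [b db] := res_proper0 P (res_in R 0) (res_map R 0).
  have [|s ds] := res_proper (p := P) (k := 0) (res_in P 0) (f := idm _ - b \oc a).
    by rewrite comp_subr comp_idr comp_assoc db ra subrr.
  (* Both comparison maps cover the identity of [M], so the homotopy is 0 on [M]. *)
  exists a, b, s, 0; split.
  - by rewrite comp_assoc ra res_complex.
  - by rewrite comp_assoc db res_complex.
  - by rewrite comp0l addr0 ds.
have [a' ra'] := res_proper (p := R) (res_in P k.+1) ra.
have [b' db'] := res_proper (p := P) (res_in R k.+1) db.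
(* By [hst], composing this map with [res_map P k.+1] leaves only
   [t \oc res_map P k \oc res_map P k.+1], which is zero. *)
have [|s' ds'] := res_proper (p := P) (k := k.+1) (res_in P k.+1)
  (f := idm _ - b' \oc a' - s \oc res_map P k.+1).
  rewrite !comp_subr comp_idr (comp_assoc (res_map P k.+1) b') db'.
  rewrite -[_ \oc a']comp_assoc ra' !comp_assoc.
  rewrite -{1}[res_map P k.+1]comp_idl -!comp_subl hst addrAC subrr add0r.
  by rewrite -comp_assoc res_complex comp0r.
exists a', b', s', s; split.
- by rewrite comp_assoc ra' -comp_assoc res_complex comp0r.
- by rewrite comp_assoc db' -comp_assoc res_complex comp0r.
- by rewrite ds' subrK.
Qed.

(** In degree [k.+1] the comparison map [a] lands in a zero object, so the identity is a sum of two
    homotopy terms. The cocycle [x] kills the one through [s]; the other exhibits [x] as the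
    coboundary of [x \oc t]. *)
Lemma rel_Ext_vanish (P : proper_resolution X M) n k N :
  dim_le X M n -> (n <= k)%N -> forall h : rel_Ext P N k.+1, h = 0.
Proof.
move=> [R zR] lenk; apply/rel_Ext0P => x xd0.
have [a [b [s [t [_ _ hst]]]]] := comparison_homotopy P R k.+1.
exists (x \oc t).
have a0 : a = 0 by apply: (zR k.+1 _).1.
rewrite a0 comp0r subr0 in hst.
by rewrite -[RHS]comp_idr hst comp_addr comp_assoc xd0 comp0l add0r comp_assoc.
Qed.

(** What is discarded in degree [n] is mapped to zero by the differential and contains all that
    arrives from degree [n.+1], so lifts in [P] still provide exactness after truncation. *)
Lemma resolution_retract (P : proper_resolution X M) n
    (S : nat -> C) (i : forall k, hom (S k) (res_obj P k))
    (p : forall k, hom (res_obj P k) (S k)) :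
  (forall k, X (S k)) ->
  (forall k, p k \oc i k = idm (S k)) ->
  (forall k, (k < n)%N -> i k \oc p k = idm (res_obj P k)) ->
  (forall k, (k <= n)%N ->
     (res_map P k : hom (res_obj P k) _) \oc (i k \oc p k) = res_map P k) ->
  (forall k, (n <= k)%N -> p k \oc (res_map P k.+1 : hom _ (res_obj P k)) = 0) ->
  (forall k, (n < k)%N -> is_zero (S k)) ->
  dim_le X M n.
Proof.
move=> XS pi ip dip pd0 S0.
(* Index [k.+1] of [pa] is degree [k]; the entry [idm M] lets one formula for [r] cover the
   augmentation too. *)
pose pa k : hom (aug M (res_obj P) k) (aug M S k) :=
  if k is k'.+1 then p k' else idm M.
pose r k : hom (aug M S k.+1) (aug M S k) :=
  pa k \oc res_map P k \oc i k.
(* Up to index [n] only degrees below [n] occur, where [p] is invertible. *)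
have pa_inj k A (f : hom A (aug M (res_obj P) k)) :
    (k <= n)%N -> pa k \oc f = 0 -> f = 0.
  case: k f => [|k] f ltkn /=; first by rewrite comp_idl.
  by move=> pf0; rewrite -[f]comp_idl -ip // -comp_assoc pf0 comp0r.
have rr0 k : r k \oc r k.+1 = 0.
  rewrite /r /=; have [lenk|ltkn] := leqP n k.
    by rewrite pd0 // comp0l comp0r.
  rewrite comp_assoc; rewrite -[_ \oc i k \oc _]comp_assoc.
  rewrite [i k \oc _]comp_assoc ip // comp_idl.
  by rewrite -[_ \oc res_map P k \oc _]comp_assoc res_complex comp0r comp0l.
have r_proper0 A : X A -> forall f : hom A M,
    exists g : hom A (S 0%N), (r 0 : hom (S 0%N) M) \oc g = f.
  move=> XA f; have [g dg] := res_proper0 P XA f; exists (p 0%N \oc g).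
  by rewrite /r /= comp_idl comp_assoc -[_ \oc p 0%N]comp_assoc dip.
have r_proper k A : X A -> forall f : hom A (S k),
    r k \oc (f : hom A (aug M S k.+1)) = 0 ->
    exists g : hom A (S k.+1), (r k.+1 : hom (S k.+1) (S k)) \oc g = f.
  move=> XA f rf0; have [ltnk|lekn] := ltnP n k.
    by exists 0; rewrite comp0r [RHS](S0 k _).1.
  have [|g dg] := res_proper (p := P) (k := k) XA (f := i k \oc f).
    by apply: (pa_inj k) => //; rewrite !comp_assoc.
  have fE : p k \oc (res_map P k.+1 \oc g) = f.
    by rewrite dg comp_assoc pi comp_idl.
  exists (p k.+1 \oc g); rewrite /r /=.
  have [ltkn|lenk] := ltnP k n.
    rewrite comp_assoc -[_ \oc i k.+1 \oc _]comp_assoc.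
    rewrite -[_ \oc _ \oc (_ \oc _)]comp_assoc.
    by rewrite dip // -comp_assoc.
  (* Here [k = n]: the lift [g] still exists, but [p n] kills its image in [P], so the only cycle is
     zero. *)
  have f0 : f = 0 by rewrite -fE comp_assoc pd0 // comp0l.
  by rewrite f0 pd0 // !comp0l.
by exists (ProperResolution XS rr0 r_proper0 r_proper).
Qed.

Lemma dim_le_of_rel_Ext (P : proper_resolution X M) n :
  abelian C -> subcategory X -> summand_closed X ->
  (forall N (h : rel_Ext P N n.+1), h = 0) -> dim_le X M n.
Proof.
move=> abC [_ X0] sumX Ext0.
have [N [q coker_q]] := has_cokernels abC (res_map P n.+2).
have q_epi := cokernel_epi coker_q.
have [qd0 qU] := coker_q.
have [h hd] := (rel_Ext0P P N n).1 (Ext0 N) q qd0.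
have [e [eq _]] := qU _ _ (res_complex P n.+1).
have he : h \oc e = idm N by apply: q_epi; rewrite -comp_assoc eq hd comp_idl.
have [Q [j ker_j]] := has_kernels abC h.
have [r bip] := split_complement he ker_j.
have XQ : X Q := sumX _ _ _ _ _ _ _ bip (res_in P n).
have [rj _ _ re0 sum1] := bip.
(* The differential vanishes on the summand [N], so projecting onto its complement [Q] does not
   alter it. *)
have de0 : res_map P n \oc e = 0.
  by apply: q_epi; rewrite -comp_assoc eq res_complex comp0l.
have [Z zZ] := has_zero abC.
(* The guards on [k] allow one choice for all degrees: the identity below [n], the complement [Q] at
   [n], and a zero object above. *)
pose retract k (t : {T : C & (hom T (res_obj P k) * hom (res_obj P k) T)%type}) :=
  let i := (projT2 t).1 in let p := (projT2 t).2 in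
  [/\ X (projT1 t), p \oc i = idm _,
      (k < n)%N -> i \oc p = idm (res_obj P k),
      (k <= n)%N ->
        (res_map P k : hom (res_obj P k) _) \oc (i \oc p) = res_map P k &
      ((n <= k)%N -> p \oc (res_map P k.+1 : hom _ (res_obj P k)) = 0) /\
      ((n < k)%N -> is_zero (projT1 t))].
have ex k : exists t, retract k t.
  have [ltkn|ltnk|->] := ltngtP k n.
  - exists (existT _ (res_obj P k) (idm _, idm _)); rewrite /retract /=.
    rewrite [(n <= k)%N]leqNgt [(n < k)%N]ltnNge ltkn (ltnW ltkn) /=.
    by split=> //; rewrite ?comp_idl ?comp_idr //; exact: res_in.
  - exists (existT _ Z (0, 0)); rewrite /retract /=.
    rewrite [(k <= n)%N]leqNgt [(k < n)%N]ltnNge ltnk (ltnW ltnk) /=.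
    by split; rewrite ?comp0l //; [exact: X0 | rewrite [RHS]zZ.1].
  - exists (existT _ Q (j, r)); rewrite /retract /= ltnn leqnn; split=> //.
      move=> _; have -> : j \oc r = idm _ - e \oc h by rewrite -sum1 addrK.
      by rewrite comp_subr comp_idr comp_assoc de0 comp0l subr0.
    by split=> // _; rewrite -eq comp_assoc re0 comp0l.
pose t k := projT1 (cid (ex k)).
have tP k : retract k (t k) := projT2 (cid (ex k)).
apply: (@resolution_retract P n (fun k => projT1 (t k)) 
  (fun k => (projT2 (t k)).1) (fun k => (projT2 (t k)).2)) => k;
  by case: (tP k) => ? ? ? ? [].
Qed.

End Resolutions.

Theorem theorem5p2 (C : preadditive) (abC : abelian C) (X : C -> Prop)
  (subX : subcategory X) (preX : precovering X) (orthX : self_orthogonal X)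
  (extX : extension_closed X) (sumX : summand_closed X)
  (faithX : Hom_faithful X)
  (M : C) (P : proper_resolution X M) (n : nat) :
  [<-> dim_le X M n;
       forall (N : C) (h : rel_Ext P N n.+1), h = 0;
       forall i : nat, (n.+1 <= i)%N ->
         forall (N : C) (h : rel_Ext P N i), h = 0].
Proof.
tfae=> [dimM N | Ext0 i leni N | Ext0].
- exact: rel_Ext_vanish dimM (leqnn n).
(* Vanishing in the single degree [n.+1] reaches the higher degrees by way of the dimension
   bound. *)
- have dimM := dim_le_of_rel_Ext abC subX sumX Ext0.
  by case: i leni => // i leni; exact: rel_Ext_vanish dimM leni.
- exact: dim_le_of_rel_Ext abC subX sumX (Ext0 n.+1 (leqnn _)).
Qed.
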